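(* The Weierstrass-type representations for discrete BrLW surfaces in hyperbolic space and discrete BiLW surfaces in de Sitter space given by the following construction can be viewed as certain applications of the $\Omega$-dual transformation to a prescribed discrete lightlike Gauss map. Construction: let $\psi:\mathbb Z^2\to\mathbb C$ be a discrete holomorphic function with edge-labelling $(m_{ij})$, and let $t\in\mathbb R$, $\lambda\in\mathbb R\setminus\{0\}$ be such that $\mathcal T_i:=1+t|\psi_i|^2\ne0$ at all vertices and $1-\frac{\lambda}{m_{ij}}\neq0$ on all edges. Let $E:\mathbb Z^2\to SL(2,\mathbb C)$ satisfy $$E_i^{-1}E_j=\frac{1}{\sqrt{1-\lambda/m_{ij}}}\begin{pmatrix}1&\psi_j-\psi_i\\ \frac{\lambda}{m_{ij}(\psi_j-\psi_i)}&1\end{pmatrix}$$ on all edges, and put $$\Lambda_i=\begin{pmatrix}0&\sqrt{\mathcal T_i}\\-\frac1{\sqrt{\mathcal T_i}}&-\frac{t\overline{\psi_i}}{\sqrt{\mathcal T_i}}\end{pmatrix},\qquad f^\pm_i=\operatorname{sgn}(\mathcal T_i)\,E_i\Lambda_i\begin{pmatrix}1&0\\0&\pm1\end{pmatrix}(E_i\Lambda_i)^\ast .$$ The representation states that $f^+$ is a discrete BrLW surface in hyperbolic space and $f^-$ is a discrete BiLW surface in de Sitter space. That is: there is a discrete lightlike Gauss map $G:\mathbb Z^2\to\mathbb P\mathcal L$ such that $f^++G$ and $f^-+G$ are discrete Legendre immersions which are $\Omega$-dual to $G$.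
   Context: **Minkowski space.** $\mathbb R^{3,1}$ is the real vector space with basis $e_0,e_1,e_2,e_3$ and product $(e_0,e_0)=-1$, $(e_n,e_n)=1$ ($n=1,2,3$), $(e_n,e_{n'})=0$ for $n\ne n'$. $\mathcal L=\{v:(v,v)=0\}$; $\mathbb P\mathcal L$ is the set of one-dimensional null subspaces; $\langle\cdot\rangle$ denotes linear span. In the Hermitian model $\mathbb R^{3,1}$ is the space of Hermitian $2\times2$ matrices with $(v,v)=-\det v$, where $e_0=\begin{pmatrix}1&0\\0&1\end{pmatrix}$, $e_1=\begin{pmatrix}0&1\\1&0\end{pmatrix}$, $e_2=\begin{pmatrix}0&\mathrm i\\-\mathrm i&0\end{pmatrix}$, $e_3=\begin{pmatrix}1&0\\0&-1\end{pmatrix}$; $B^\ast=\overline B^T$. Hyperbolic space is understood as $\{(x,x)=-1\}$ (two copies of $\mathbb H^3$) and de Sitter space as $\mathbb S^{2,1}=\{(x,x)=1\}$. **Discrete holomorphic.** $(ijkl)$ denotes an elementary quadrilateral (face) of $\mathbb Z^2$ with vertices in cyclic order. $\psi:\mathbb Z^2\to\mathbb C$ is discrete holomorphic if there is a real nowhere zero edge function $m_{ij}=m_{ji}$, equal on opposite edges of each face ($m_{ij}=m_{lk}$, $m_{il}=m_{jk}$), with $\frac{\psi_i-\psi_j}{\psi_j-\psi_k}\frac{\psi_k-\psi_l}{\psi_l-\psi_i}=\frac{m_{il}}{m_{ij}}<0$ on each face. The (possibly imaginary) square roots $\sqrt{1-\lambda/m_{ij}}$ are chosen independently of the direction of an edge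 and equal on opposite edges of a face. **Discrete surfaces.** A discrete surface is a map $x:\mathbb Z^2\to\mathbb R^{3,1}$; $dx_{ij}=x_i-x_j$ on edges, $\delta x_{ik}=x_i-x_k$ on diagonals. It is planar if each face is mapped to coplanar points, and circular if it is planar and for each face there is $c\in\mathbb R^{3,1}$ with $(x-c,x-c)$ equal at its four vertices. Two discrete surfaces $x,y$ are edge-parallel if $dx_{ij},dy_{ij}$ are parallel on every edge; for these the mixed area is $A(x,y)_{ijkl}=\frac14(\delta x_{ik}\wedge\delta y_{jl}-\delta x_{jl}\wedge\delta y_{ik})\in\Lambda^2\mathbb R^{3,1}$. Standing assumption: discrete surfaces for which curvatures are considered satisfy $A(x,x)\neq0$ on every face. A discrete Legendre immersion is a map $L$ from $\mathbb Z^2$ to the affine null lines of $\mathbb R^{3,1}$ with $L_i\cap L_j\ne\emptyset$ for every edge; it has the form $L=x+G$ with $x_i\in L_i$ and lightlike Gauss map $G:\mathbb Z^2\to\mathbb P\mathcal L$. Sections of $L$, $G$: maps $y$ with $y_i\in L_i$, resp. nowhere zero $g$ with $\langle g_i\rangle=G_i$. Also assumed: on each face the four lines of $G$ span a space of dimension at least $3$. **BrLW/BiLW.** Let $x^{+}$ (resp. $x^-$) be a circular discrete surface with $(x^\pm,x^\pm)=\mp1$, and $G:\mathbb Z^2\to\mathbb P\mathcal L$ such that $x^\pm+G$ is a discrete Legendre immersion and $x^\pm_i\not\perp G_i$. For any section $g$ of $G$ put $n^\pm=\mp\frac{g}{(g,x^\pm)}-x^\pm$. The discrete mean curvature $H$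 and extrinsic Gauss curvature $K$ are defined on faces by $A(x^\pm,n^\pm)+HA(x^\pm,x^\pm)=0$ and $A(n^\pm,n^\pm)-KA(x^\pm,x^\pm)=0$. $x^+$ is BrLW (linear Weingarten of Bryant type), resp. $x^-$ is BiLW (of Bianchi type), if for some $\mu\in\mathbb R$ one has $(\mu\pm1)K-2\mu H+(\mu\mp1)=0$ on all faces (for $f^\pm$ above, $\mu=-t$). **$\Omega$-duality.** Two discrete surfaces are Christoffel dual if they are edge-parallel, circular, and have vanishing mixed area. A Legendre immersion $L$ with lightlike Gauss map $G$ is $\Omega$-dual to $G$ (equivalently: $L$ is discrete L-isothermic) if there are sections $y$ of $L$ and $g$ of $G$ which are Christoffel dual.
   Formalization: Where 1−λ/m_ij<0 the literal f^± jumps by a sign along the edge and need not be planar, so the claim is shown for ε_i f^±_i, with signs ε_i=±1 satisfying ε_iε_j=sgn(1−λ/m_ij), and ε≡1 if all 1−λ/m_ij>0. *)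

(* Defs.v *)
From mathcomp Require Import all_boot all_order all_algebra.
From mathcomp Require Import reals complex ring.
Set Implicit Arguments.
Unset Strict Implicit.
Unset Printing Implicit Defensive.
Import Order.TTheory GRing.Theory Num.Theory.
Local Open Scope ring_scope.
Local Open Scope complex_scope.

(** * The square lattice *)

Definition vertex : Type := (int * int)%type.

Definition edge (i j : vertex) : bool := `|i.1 - j.1| + `|i.2 - j.2| == 1.

(* The elementary quadrilaterals of Z^2 are exactly its 4-cycles.  Every cyclic
   relabelling of a face is again a face; the notions below do not depend on
   the labelling. *)
Definition face (i j k l : vertex) : bool :=
  [&& edge i j, edge j k, edge k l, edge l i, i != k & j != l].

(** * Minkowski space *)

(* R^{3,1}, in coordinates with respect to e_0, e_1, e_2, e_3 *)
Notation mink_space R := 'rV[R]_4.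

Section Minkowski.
Variable R : realType.

Local Notation mink_space := (mink_space R).
Implicit Types (u v p q : mink_space) (U : {vspace mink_space}).

Definition mink u v : R :=
  \sum_(n < 4) (if n == 0 then -1 else 1) * u 0 n * v 0 n.

Definition null_line U : Prop :=
  \dim U = 1%N /\ forall v, v \in U -> mink v v = 0.

Definition affine_line p U : {pred mink_space} := [pred q | q - p \in U].

Definition parallel u v : Prop := (\dim <<[:: u; v]>> <= 1)%N.

(* The exterior square is modelled by alternating 4 x 4 matrices. *)
Definition wedge u v : 'M[R]_4 := u^T *m v - v^T *m u.

(** ** Hermitian model *)

Definition mx2 (a b c d : R[i]) : 'M[R[i]]_2 :=
  \matrix_(r < 2, s < 2)
    if r == 0 then (if s == 0 then a else b) else (if s == 0 then c else d).

Definition adjmx (A : 'M[R[i]]_2) : 'M[R[i]]_2 := (map_mx conjc A)^T.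

Definition herm_basis (n : 'I_4) : 'M[R[i]]_2 :=
  match val n with
  | 0 => mx2 1 0 0 1
  | 1 => mx2 0 1 1 0
  | 2 => mx2 0 'i (- 'i) 0
  | _ => mx2 1 0 0 (-1)
  end.

Definition to_herm v : 'M[R[i]]_2 :=
  \sum_(n < 4) (v 0 n)%:C *: herm_basis n.

(* Inverse of [to_herm] on Hermitian matrices, see [of_hermK] *)
Definition of_herm (A : 'M[R[i]]_2) : mink_space :=
  \row_(n < 4)
    match val n with
    | 0 => (complex.Re (A 0 0) + complex.Re (A 1 1)) / 2
    | 1 => complex.Re (A 0 1)
    | 2 => complex.Im (A 0 1)
    | _ => (complex.Re (A 0 0) - complex.Re (A 1 1)) / 2
    end.

Lemma to_hermE v :
  to_herm v = mx2 (v 0 0 + v 0 3)%:C (v 0 1 +i* v 0 2)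
                  (v 0 1 -i* v 0 2) (v 0 0 - v 0 3)%:C.
Proof.
have e0 : @ord0 3 = 0 by apply/val_inj.
have e1 : lift ord0 ord0 = 1 :> 'I_4 by apply/val_inj.
have e2 : lift ord0 (lift ord0 ord0) = 2 :> 'I_4 by apply/val_inj.
have e3 : lift ord0 (lift ord0 (lift ord0 ord0)) = 3 :> 'I_4 by apply/val_inj.
rewrite /to_herm !big_ord_recl big_ord0 e0 e1 e2 e3 /herm_basis /=.
apply/matrixP => -[[|[|//]] r] [[|[|//]] s]; rewrite !mxE /=;
  apply/eqP; rewrite eq_complex /=;
  by rewrite !(mulr0, mulr1, mul0r, mulrN, add0r, addr0, subr0, oppr0, mulrN1,
    mul1r, eqxx).
Qed.

Lemma to_hermK : cancel to_herm of_herm.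
Proof.
move=> v; rewrite to_hermE; apply/rowP => -[[|[|[|[|//]]]] n]; rewrite !mxE /=.
- rewrite addrACA subrr addr0 -mulr2n -[_ *+ 2]mulr_natr mulfK ?pnatr_eq0 //.
  by congr (v 0 _); apply/val_inj.
- by congr (v 0 _); apply/val_inj.
- by congr (v 0 _); apply/val_inj.
- rewrite opprB addrC addrA subrK -mulr2n -[_ *+ 2]mulr_natr.
  by rewrite mulfK ?pnatr_eq0 //; congr (v 0 _); apply/val_inj.
Qed.

Lemma adj_to_herm v : adjmx (to_herm v) = to_herm v.
Proof.
rewrite to_hermE; apply/matrixP => -[[|[|//]] r] [[|[|//]] s].
all: by rewrite !mxE /= ?opprK ?oppr0.
Qed.

Lemma of_hermK (A : 'M[R[i]]_2) : adjmx A = A -> to_herm (of_herm A) = A.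
Proof.
move=> AA; have AE r s : A r s = (A s r)^* by rewrite -{1}AA !mxE.
have o0 (h : (0 < 2)%N) : Ordinal h = 0 :> 'I_2 by apply/val_inj.
have o1 (h : (1 < 2)%N) : Ordinal h = 1 :> 'I_2 by apply/val_inj.
have re r : A r r = (complex.Re (A r r))%:C.
  have := AE r r; case: (A r r) => a b /= [] /eqP.
  by rewrite -subr_eq0 opprK -mulr2n mulrn_eq0 /= => /eqP ->.
rewrite to_hermE; apply/matrixP => -[[|[|//]] r] [[|[|//]] s].
- rewrite !mxE /= !o0 (re 0) /=; apply/eqP; rewrite eq_complex /=.
  by apply/andP; split; apply/eqP; field.
- by rewrite !mxE /= !o0 o1; case: (A 0 1).
- by rewrite !mxE /= o0 o1 [RHS]AE; case: (A 0 1).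
- rewrite !mxE /= !o1 (re 1) /=; apply/eqP; rewrite eq_complex /=.
  by apply/andP; split; apply/eqP; field.
Qed.

Lemma mink_det v : (mink v v)%:C = - \det (to_herm v).
Proof.
rewrite to_hermE (expand_det_row _ 0) !big_ord_recl big_ord0 /cofactor !det_mx11.
have e0 : @ord0 3 = 0 by apply/val_inj.
have e1 : lift ord0 ord0 = 1 :> 'I_4 by apply/val_inj.
have e2 : lift ord0 (lift ord0 ord0) = 2 :> 'I_4 by apply/val_inj.
have e3 : lift ord0 (lift ord0 (lift ord0 ord0)) = 3 :> 'I_4 by apply/val_inj.
rewrite /mink !big_ord_recl big_ord0 e0 e1 e2 e3 !mxE /=.
rewrite /bump /= !(addn0, expr0, expr1, mul1r, addr0, mulN1r).
by apply/eqP; rewrite eq_complex /=; apply/andP; split; apply/eqP; ring.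
Qed.

(** * Discrete surfaces *)

Definition surface : Type := vertex -> mink_space.
Implicit Types (x y g : surface) (G : vertex -> {vspace mink_space}).

Definition coplanar (p1 p2 p3 p4 : mink_space) : Prop :=
  (\dim <<[:: p2 - p1; p3 - p1; p4 - p1]%R>> <= 2)%N.

Definition planar x : Prop :=
  forall i j k l, face i j k l -> coplanar (x i) (x j) (x k) (x l).

Definition circular x : Prop :=
  planar x /\
  forall i j k l, face i j k l ->
    exists (c : mink_space) (r : R),
      forall h, h \in [:: i; j; k; l] -> mink (x h - c) (x h - c) = r.

Definition edge_parallel x y : Prop :=
  forall i j, edge i j -> parallel (x i - x j) (y i - y j).

Definition mixed_area x y (i j k l : vertex) : 'M[R]_4 :=
  4^-1 *: (wedge (x i - x k) (y j - y l) - wedge (x j - x l) (y i - y k)).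

Definition christoffel_dual x y : Prop :=
  [/\ edge_parallel x y, circular x, circular y
    & forall i j k l, face i j k l -> mixed_area x y i j k l = 0].

Definition regular_surface x : Prop :=
  forall i j k l, face i j k l -> mixed_area x x i j k l != 0.

(** ** Legendre immersions and Omega-duality *)

Definition lightlike_gauss_map G : Prop :=
  (forall i, null_line (G i)) /\
  (forall i j k l, face i j k l -> (3 <= \dim (G i + G j + G k + G l))%N).

(* The pair (x, G) represents L = x + G, i.e. L_i = affine_line (x i) (G i). *)
Definition legendre_immersion x G : Prop :=
  lightlike_gauss_map G /\
  forall i j, edge i j ->
    exists p, p \in affine_line (x i) (G i) /\ p \in affine_line (x j) (G j).

Definition line_section x G y : Prop :=
  forall i, y i \in affine_line (x i) (G i).

Definition gauss_section G g : Prop :=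
  forall i, g i != 0 /\ <[g i]>%VS = G i.

Definition omega_dual x G : Prop :=
  legendre_immersion x G /\
  exists y g, [/\ line_section x G y, gauss_section G g & christoffel_dual y g].

(** ** Linear Weingarten surfaces of Bryant and Bianchi type *)

(* s = 1 for x^+ and s = -1 for x^- *)
Definition gauss_normal (s : R) x g : surface :=
  fun i => - (s / mink (g i) (x i)) *: g i - x i.

Definition linear_weingarten (s : R) x G : Prop :=
  [/\ forall i, mink (x i) (x i) = - s,
      circular x /\ regular_surface x,
      legendre_immersion x G,
      forall g, gauss_section G g -> forall i, mink (x i) (g i) != 0
    & exists mu : R,
        forall g, gauss_section G g ->
        forall i j k l, face i j k l ->
        exists H K : R,
          [/\ mixed_area x (gauss_normal s x g) i j k l
                + H *: mixed_area x x i j k l = 0,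
              mixed_area (gauss_normal s x g) (gauss_normal s x g) i j k l
                - K *: mixed_area x x i j k l = 0
            & (mu + s) * K - 2 * mu * H + (mu - s) = 0]].

Definition BrLW x G : Prop := linear_weingarten 1 x G.
Definition BiLW x G : Prop := linear_weingarten (-1) x G.

(** * Discrete holomorphic functions and the representation *)

Implicit Types (m : vertex -> vertex -> R) (psi : vertex -> R[i]).

(* Edge functions are functions of two vertices whose values on non-adjacent
   pairs are irrelevant. *)
Definition edge_labelling m : Prop :=
  (forall i j, edge i j -> m i j != 0 /\ m i j = m j i) /\
  (forall i j k l, face i j k l -> m i j = m l k /\ m i l = m j k).

(* As division by 0 yields 0, the sign condition forces all four differences
   to be nonzero. *)
Definition discrete_holomorphic m psi : Prop :=
  edge_labelling m /\
  forall i j k l, face i j k l ->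
    (psi i - psi j) / (psi j - psi k) * ((psi k - psi l) / (psi l - psi i))
      = (m i l / m i j)%:C
    /\ m i l / m i j < 0.

(* A choice sg of the square roots of 1 - lam / m_ij *)
Definition edge_sqrt m (lam : R) (sg : vertex -> vertex -> R[i]) : Prop :=
  (forall i j, edge i j ->
     sg i j ^+ 2 = (1 - lam / m i j)%:C /\ sg i j = sg j i) /\
  (forall i j k l, face i j k l -> sg i j = sg l k /\ sg i l = sg j k).

Definition transition m lam (sg : vertex -> vertex -> R[i]) psi (i j : vertex) :
    'M[R[i]]_2 :=
  (sg i j)^-1 *: mx2 1 (psi j - psi i)
                     (lam%:C / ((m i j)%:C * (psi j - psi i))) 1.

(* 1 + t |psi|^2, written with real and imaginary parts so as to be real *)
Definition calT (t : R) psi (i : vertex) : R :=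
  1 + t * (complex.Re (psi i) ^+ 2 + complex.Im (psi i) ^+ 2).

Definition Lam (t : R) psi (i : vertex) : 'M[R[i]]_2 :=
  let rT := sqrtC (calT t psi i)%:C in
  mx2 0 rT (- rT^-1) (- (t%:C * (psi i)^* / rT)).

(* f^+ for s = 1 and f^- for s = -1 *)
Definition weierstrass (s : R) (t : R) psi (E : vertex -> 'M[R[i]]_2) : surface :=
  fun i => of_herm ((Num.sg (calT t psi i))%:C *:
    (E i *m Lam t psi i *m mx2 1 0 0 s%:C *m adjmx (E i *m Lam t psi i))).

Lemma adj_weierstrass (s t : R) psi (E : vertex -> 'M[R[i]]_2) i :
  let A := (Num.sg (calT t psi i))%:C *:
    (E i *m Lam t psi i *m mx2 1 0 0 s%:C *m adjmx (E i *m Lam t psi i)) in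
  adjmx A = A.
Proof.
rewrite /= /adjmx map_mxZ linearZ /= oppr0; congr (_ *: _).
move: (E i *m _) => B; rewrite !map_mxM !trmx_mul mulmxA; congr (_ *m _ *m _).
  by apply/matrixP => r q; rewrite !mxE /= conjcK.
by apply/matrixP => -[[|[|//]] r] [[|[|//]] q]; rewrite !mxE /= ?oppr0.
Qed.

(* If 1 - lam / m_ij < 0 on an edge, its square root is imaginary and
   B |-> B B^* changes sign along that edge, so the formula for f^+ jumps to
   the other sheet of the hyperboloid (relative to a Legendre immersion).
   [eps] undoes these jumps; it is identically 1 when all 1 - lam / m_ij are
   positive. *)
Definition edge_sign m (lam : R) (eps : vertex -> R) : Prop :=
  [/\ forall i, eps i = 1 \/ eps i = -1,
      forall i j, edge i j -> eps i * eps j = Num.sg (1 - lam / m i j)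
    & (forall i j, edge i j -> 0 < 1 - lam / m i j) -> forall i, eps i = 1].

End Minkowski.

(* Main.v *)
Require Import Defs.
From mathcomp Require Import all_boot all_order all_algebra.
From mathcomp Require boolp.
From mathcomp Require Import reals complex ring zify.
Set Implicit Arguments.
Unset Strict Implicit.
Unset Printing Implicit Defensive.
Import Order.TTheory GRing.Theory Num.Theory.
Local Open Scope ring_scope.
Local Open Scope complex_scope.

(** With Y = [[T, -t psi], [-t conj(psi), t]] and N = diag(0, 1), the vectors
    y = E Y E^* and g = T^-1 E N E^* satisfy (y,y) = -t, (y,g) = -1/2,
    (g,g) = 0 and f^s = s y + (1 - s t) g.  Along an edge dy is a multiple of
    dg: y_j - y_i = K_ij (T_i n_j - T_j n_i) with n = T g and
    K_ij = lambda / (m_ij |psi_j - psi_i|^2).  The case t = 0 of this identity,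
    summed around a face, is a linear relation between the four n's with
    coefficients K_li - K_ij, ...; the cross-ratio condition makes the T's
    satisfy the same relation.  Eliminating one vertex shows that each diagonal
    of y is a multiple of the other diagonal of g, so that s y and g are
    Christoffel dual, and that all mixed areas are multiples of A(g,g), which
    reduces the linear Weingarten relation with mu = -t to algebra. *)

(** * Two-by-two complex matrices and the Hermitian model *)

Section Hermitian.
Variable R : realType.
Implicit Types (A B E M : 'M[R[i]]_2) (a b c d z : R[i]) (x : R).

Lemma ord2P (P : 'I_2 -> Prop) : P 0 -> P 1 -> forall i, P i.
Proof.
by move=> P0 P1 [[|[|//]] h]; [move: P0 | move: P1]; congr P; apply/val_inj.
Qed.

Lemma mx2P A B : A 0 0 = B 0 0 -> A 0 1 = B 0 1 -> A 1 0 = B 1 0 ->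
  A 1 1 = B 1 1 -> A = B.
Proof. by move=> *; apply/matrixP; apply: ord2P; apply: ord2P. Qed.

Lemma mx2M a b c d a' b' c' d' : mx2 a b c d *m mx2 a' b' c' d' =
  mx2 (a * a' + b * c') (a * b' + b * d') (c * a' + d * c') (c * b' + d * d').
Proof.
have e : lift ord0 ord0 = 1 :> 'I_2 by apply/val_inj.
by apply: mx2P; rewrite !mxE !big_ord_recl big_ord0 e !mxE /= addr0.
Qed.

Lemma mx2D a b c d a' b' c' d' : mx2 a b c d + mx2 a' b' c' d' =
  mx2 (a + a') (b + b') (c + c') (d + d').
Proof. by apply: mx2P; rewrite !mxE. Qed.

Lemma mx2N a b c d : - mx2 a b c d = mx2 (- a) (- b) (- c) (- d).
Proof. by apply: mx2P; rewrite !mxE. Qed.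

Lemma mx2Z z a b c d : z *: mx2 a b c d = mx2 (z * a) (z * b) (z * c) (z * d).
Proof. by apply: mx2P; rewrite !mxE. Qed.

Lemma adjmx2 a b c d : adjmx (mx2 a b c d) = mx2 a^* c^* b^* d^*.
Proof. by apply: mx2P; rewrite !mxE. Qed.

Lemma det_mx2 a b c d : \det (mx2 a b c d) = a * d - b * c.
Proof.
have e : lift ord0 ord0 = 1 :> 'I_2 by apply/val_inj.
rewrite (expand_det_row _ 0) !big_ord_recl big_ord0 /cofactor !det_mx11 e !mxE /=.
by rewrite /bump /= !(addn0, expr0, expr1, mul1r, addr0, mulN1r, mulrN).
Qed.

Lemma adjmxM A B : adjmx (A *m B) = adjmx B *m adjmx A.
Proof. by rewrite /adjmx map_mxM trmx_mul. Qed.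

Lemma adjmxZ z A : adjmx (z *: A) = z^* *: adjmx A.
Proof. by rewrite /adjmx map_mxZ linearZ. Qed.

Lemma adjmxK A : adjmx (adjmx A) = A.
Proof. by apply/matrixP => r s; rewrite !mxE conjcK. Qed.

Lemma det_adjmx A : \det (adjmx A) = (\det A)^*.
Proof. by rewrite /adjmx det_tr det_map_mx. Qed.

(** For [\det E = 1] this is the action of SL(2,C) on Hermitian matrices by Lorentz
    transformations. *)
Definition hconj E A := E *m A *m adjmx E.

Lemma hconjM E M A : hconj (E *m M) A = hconj E (hconj M A).
Proof. by rewrite /hconj adjmxM !mulmxA. Qed.

Lemma hconjD E A B : hconj E (A + B) = hconj E A + hconj E B.
Proof. by rewrite /hconj mulmxDr mulmxDl. Qed.

Lemma hconjZ E z A : hconj E (z *: A) = z *: hconj E A.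
Proof. by rewrite /hconj -scalemxAr -scalemxAl. Qed.

Lemma hconjN E A : hconj E (- A) = - hconj E A.
Proof. by rewrite /hconj mulmxN mulNmx. Qed.

Lemma hconj_scale z E A : hconj (z *: E) A = (z * z^*) *: hconj E A.
Proof. by rewrite /hconj adjmxZ -!scalemxAl -scalemxAr scalerA. Qed.

Lemma adj_hconj E A : adjmx A = A -> adjmx (hconj E A) = hconj E A.
Proof. by move=> hA; rewrite /hconj !adjmxM adjmxK hA mulmxA. Qed.

Lemma det_hconj E A : \det E = 1 -> \det (hconj E A) = \det A.
Proof. by move=> dE; rewrite /hconj !det_mulmx det_adjmx dE rmorph1 mul1r mulr1. Qed.

Lemma of_hermD A B : of_herm (A + B) = of_herm A + of_herm B.
Proof.
apply/rowP => -[[|[|[|[|//]]]] n]; rewrite !mxE /=;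
  move: (A 0 0) (A 0 1) (A 1 1) (B 0 0) (B 0 1) (B 1 1).
all: by move=> [? ?] [? ?] [? ?] [? ?] [? ?] [? ?] /=; field.
Qed.

Lemma of_hermZ x A : of_herm (x%:C *: A) = x *: of_herm A.
Proof.
apply/rowP => -[[|[|[|[|//]]]] n]; rewrite !mxE /=; move: (A 0 0) (A 0 1) (A 1 1).
all: by move=> [? ?] [? ?] [? ?] /=; field.
Qed.

Lemma of_herm_hconjZ E x A :
  of_herm (hconj E (x%:C *: A)) = x *: of_herm (hconj E A).
Proof. by rewrite hconjZ of_hermZ. Qed.

Lemma of_hermN A : of_herm (- A) = - of_herm A.
Proof.
apply/rowP => -[[|[|[|[|//]]]] n]; rewrite !mxE /=; move: (A 0 0) (A 0 1) (A 1 1).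
all: by move=> [? ?] [? ?] [? ?] /=; field.
Qed.

Lemma minkC (u v : mink_space R) : mink u v = mink v u.
Proof. by apply: eq_bigr => n _; rewrite mulrAC. Qed.

Lemma minkDl (u v w : mink_space R) : mink (u + v) w = mink u w + mink v w.
Proof.
rewrite /mink -big_split; apply: eq_bigr => n _.
by rewrite mxE mulrDr mulrDl.
Qed.

Lemma minkZl x (u v : mink_space R) : mink (x *: u) v = x * mink u v.
Proof.
rewrite /mink mulr_sumr; apply: eq_bigr => n _.
by rewrite mxE; ring.
Qed.

Lemma minkDr (u v w : mink_space R) : mink u (v + w) = mink u v + mink u w.
Proof. by rewrite minkC minkDl !(minkC u). Qed.

Lemma minkZr x (u v : mink_space R) : mink u (x *: v) = x * mink u v.
Proof. by rewrite minkC minkZl minkC. Qed.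

(** Polarisation of (v,v) = - det v. *)
Lemma mink_of_herm A B : adjmx A = A -> adjmx B = B ->
  (2 * mink (of_herm A) (of_herm B))%:C = \det A + \det B - \det (A + B).
Proof.
move=> hA hB.
have hAB : adjmx (A + B) = A + B.
  by rewrite -[in RHS]hA -[in RHS]hB; apply/matrixP => r s; rewrite !mxE rmorphD.
have -> : 2 * mink (of_herm A) (of_herm B) = mink (of_herm (A + B)) (of_herm (A + B))
    - mink (of_herm A) (of_herm A) - mink (of_herm B) (of_herm B).
  by rewrite of_hermD !(minkDl, minkDr) (minkC (of_herm B) (of_herm A)); ring.
rewrite !rmorphB /= !mink_det !of_hermK //; ring.
Qed.

(** A square root of a real number is real or purely imaginary. All sign corrections, for the roots
    of [T] and for those of [1 - lam / m], come from here. *)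
Lemma conj_sqrt z x : z ^+ 2 = x%:C -> z^* = (Num.sg x)%:C * z.
Proof.
case: z => a b /eqP; rewrite expr2 eq_complex /= => /andP[/eqP hx /eqP hb].
have /eqP : a * b = 0 by apply/(mulfI (x := 2)); rewrite ?pnatr_eq0 // mulr0 -hb; ring.
have hx2 : x = a ^+ 2 - b ^+ 2 by rewrite -hx; ring.
rewrite mulf_eq0 => /orP[] /eqP z0; rewrite z0 in hx2 *.
  have [->|b0] := eqVneq b 0; apply/eqP; rewrite eq_complex /=.
    by rewrite !(mulr0, mul0r, subr0, addr0, oppr0) !eqxx.
  have -> : Num.sg x = -1 by rewrite hx2 expr0n sub0r sgrN gtr0_sg // exprn_even_gt0.
  by apply/andP; split; apply/eqP; ring.
have [->|a0] := eqVneq a 0; apply/eqP; rewrite eq_complex /=.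
  by rewrite !(mulr0, mul0r, subr0, addr0, oppr0) !eqxx.
have -> : Num.sg x = 1 by rewrite hx2 expr0n subr0 gtr0_sg // exprn_even_gt0.
by apply/andP; split; apply/eqP; ring.
Qed.

End Hermitian.

(** * The edge identity, seen from the frame at one endpoint *)

Section Frame.
Variable R : realType.
Implicit Types (p q d z : R[i]) (t lam m x s : R).

(** Real-valued, and of a shape that makes [Tval t (psi i)] convertible to [calT t psi i]. *)
Definition normsq z : R := complex.Re z ^+ 2 + complex.Im z ^+ 2.

Lemma normsqE z : (normsq z)%:C = z * z^*%C.
Proof.
by case: z => a b; apply/eqP; rewrite eq_complex /normsq /=; apply/andP; split;
  apply/eqP; ring.
Qed.

Lemma normsq_eq0 z : (normsq z == 0) = (z == 0).
Proof.
case: z => a b; rewrite /normsq eq_complex /=.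
by rewrite paddr_eq0 ?sqr_ge0 // !sqrf_eq0.
Qed.

Lemma conjC_eq0 z : (z^*%C == 0) = (z == 0).
Proof. by case: z => a b; rewrite !eq_complex /= oppr_eq0. Qed.

Definition Tval t p : R := 1 + t * normsq p.

Definition Ymx t p : 'M[R[i]]_2 :=
  mx2 (Tval t p)%:C (- (t%:C * p)) (- (t%:C * p^*%C)) t%:C.

Definition Nmx : 'M[R[i]]_2 := mx2 0 0 0 1.

Definition kcoef lam m d : R := lam / (m * normsq d).

Lemma conjC_real x : (x%:C)^*%C = x%:C.
Proof. by rewrite /= oppr0. Qed.

Lemma TvalE t p : (Tval t p)%:C = 1 + t%:C * (p * p^*%C).
Proof. by rewrite -normsqE -rmorphM -(rmorphD (real_complex R) 1). Qed.

Lemma kcoefE lam m d : (kcoef lam m d)%:C = lam%:C / (m%:C * (d * d^*%C)).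
Proof. by rewrite -normsqE -rmorphM -fmorph_div. Qed.

Lemma conjC_transition lam m d : (lam%:C / (m%:C * d))^*%C = lam%:C / (m%:C * d^*%C).
Proof. by rewrite fmorph_div rmorphM /= !oppr0. Qed.

(** This is the edge formula for y_j - y_i pulled back by E_i, so that E no longer occurs. [M] is
    the transition matrix without its square root, and [Q] is what that root contributes, up to a
    sign. *)
Lemma hconj_transition t lam m p q :
  m != 0 -> q - p != 0 -> 1 - lam / m != 0 ->
  let Q := (1 - lam / m)^-1 in
  let M := mx2 1 (q - p) (lam%:C / (m%:C * (q - p))) 1 in
  Q%:C *: hconj M (Ymx t q) = Ymx t p + (kcoef lam m (q - p))%:C *:
    ((Tval t p)%:C *: (Q%:C *: hconj M Nmx) - (Tval t q)%:C *: Nmx).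
Proof.
move=> m0 d0 q0 /=.
have mC : m%:C != 0 by rewrite fmorph_eq0.
have mq : m - lam != 0.
  apply: contraNneq q0 => /eqP.
  by rewrite subr_eq0 => /eqP <-; rewrite divff ?subrr.
have qC : m%:C - lam%:C != 0 by rewrite -rmorphB fmorph_eq0.
have dC : (q - p)^*%C != 0 by rewrite conjC_eq0.
have -> : (1 - lam / m)^-1%:C = m%:C / (m%:C - lam%:C).
  rewrite -rmorphB -fmorph_div; congr (_%:C); field.
  by rewrite m0 mq.
rewrite /hconj /Ymx /Nmx !adjmx2 !mx2M !mx2Z mx2N !mx2D ?mx2Z ?mx2D.
have c1 : (1 : R[i])^*%C = 1 by exact: rmorph1.
have dE : (q - p)^*%C = q^*%C - p^*%C by exact: rmorphB.
rewrite conjC_transition !TvalE kcoefE c1 !dE in dC *.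
(* The conjugates become independent variables: each entry is an identity of rational functions in
   [p], [q], [p'], [q']. *)
move: (p^*%C) (q^*%C) dC => p' q' dC.
by congr mx2; field; rewrite ?mC ?qC ?dC ?d0.
Qed.

End Frame.
Arguments Nmx {R}.

(** * Decomposition of the points f^s in terms of y and g *)

Section Points.
Variable R : realType.
Implicit Types (p q d z : R[i]) (t lam m x s : R) (E : 'M[R[i]]_2).

(** This is f^s = s y + (1 - s t) g before the action of E_i. *)
Lemma hconj_Lam s t (psi : vertex -> R[i]) i : calT t psi i != 0 ->
  (Num.sg (calT t psi i))%:C *: hconj (Lam t psi i) (mx2 1 0 0 s%:C) =
  s%:C *: Ymx t (psi i) + ((1 - s * t) / calT t psi i)%:C *: Nmx.
Proof.
rewrite /Lam -[calT t psi i]/(Tval t (psi i)) -[Num.conj _]/(conjc (psi i)).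
move: (psi i) => p T0.
have := TvalE t p; rewrite /Ymx.
move: (Tval t p) T0 => T T0 TE; set r := sqrtC _; set sgn := (Num.sg T)%:C.
have rE : T%:C = r ^+ 2 by rewrite sqrtCK.
have r0 : r != 0 by rewrite sqrtC_eq0 fmorph_eq0.
(* For negative [T] the root is imaginary; the sign produced by its conjugation is compensated by
   the factor [sgn] in front. *)
have rc : r^*%C = sgn * r by exact: conj_sqrt.
have s0 : sgn != 0 by rewrite fmorph_eq0 sgr_eq0.
have s2 : sgn ^+ 2 = 1 by rewrite -rmorphXn /= sqr_sg T0.
have -> : ((1 - s * t) / T)%:C = (1 - s%:C * t%:C) / r ^+ 2.
  by rewrite fmorph_div rmorphB rmorphM /= rE.
have ac : (- (t%:C * p^*%C / r))^*%C = - (t%:C * p / (sgn * r)).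
  by rewrite rmorphN fmorph_div rmorphM /= conjcK rc oppr0.
have bc : (- r^-1)^*%C = - (sgn * r)^-1 by rewrite rmorphN fmorphV /= rc.
rewrite /hconj !adjmx2 ac bc rc !(conjC_real 0) !mx2M !mx2Z mx2D rE.
rewrite rE in TE.
have {}TE : t%:C * p * p^*%C = r ^+ 2 - 1 by rewrite TE; ring.
by congr mx2; field: s2 TE; rewrite ?r0 ?s0.
Qed.

Lemma weierstrassE s t (psi : vertex -> R[i]) (E : vertex -> 'M[R[i]]_2) i :
  calT t psi i != 0 ->
  weierstrass s t psi E i = s *: of_herm (hconj (E i) (Ymx t (psi i))) +
    ((1 - s * t) / calT t psi i) *: of_herm (hconj (E i) Nmx).
Proof.
by move=> T0; rewrite -!of_hermZ -of_hermD -!hconjZ -hconjD -hconj_Lam // hconjZ -hconjM.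
Qed.

End Points.

(** * Minkowski products of the basic vectors *)

Section Products.
Variable R : realType.
Implicit Types (p q d z : R[i]) (t lam m x s : R) (A B E : 'M[R[i]]_2).

(** By [mink_of_herm] the product is a combination of determinants, which [hconj E] preserves. *)
Lemma mink_hconj E A B : \det E = 1 -> adjmx A = A -> adjmx B = B ->
  mink (of_herm (hconj E A)) (of_herm (hconj E B)) =
  mink (of_herm A) (of_herm B).
Proof.
(* The polarised formula concerns [2 * mink] inside [R[i]], so the equation is doubled and then
   embedded there. *)
move=> dE hA hB; apply: (mulfI (x := 2)); first by rewrite pnatr_eq0.
apply: (fmorph_inj (real_complex R)).
by rewrite /= !mink_of_herm ?adj_hconj // -hconjD !det_hconj.
Qed.

Lemma adj_Ymx t p : adjmx (Ymx t p) = Ymx t p.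
Proof. by rewrite adjmx2 !rmorphN !rmorphM /= conjcK !oppr0. Qed.

Lemma adj_Nmx : adjmx (Nmx : 'M[R[i]]_2) = Nmx.
Proof. by rewrite adjmx2 rmorph1 rmorph0. Qed.

Lemma mink_Ymx t p : mink (of_herm (Ymx t p)) (of_herm (Ymx t p)) = - t.
Proof.
apply: (mulfI (x := 2)); first by rewrite pnatr_eq0.
apply: (fmorph_inj (real_complex R)).
rewrite [LHS]mink_of_herm ?adj_Ymx // mx2D !det_mx2 rmorphM rmorphN /=.
by rewrite TvalE rmorphMn rmorph1; ring.
Qed.

Lemma mink_YN t p : mink (of_herm (Ymx t p)) (of_herm Nmx) = - Tval t p / 2.
Proof.
apply: (mulfI (x := 2)); first by rewrite pnatr_eq0.
rewrite [RHS]mulrC divfK ?pnatr_eq0 //.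
apply: (fmorph_inj (real_complex R)).
rewrite [LHS]mink_of_herm ?adj_Ymx ?adj_Nmx // mx2D !det_mx2 rmorphN /=.
by ring.
Qed.

(** Conjugating [Nmx] gives the rank one matrix v v^* of the second column v = (d, 1), so [c] drops
    out. The product of two such null vectors is - |det (v, v')|^2 / 2. *)
Lemma mink_Nmx_conj d d' c c' :
  mink (of_herm (hconj (mx2 1 d c 1) Nmx)) (of_herm (hconj (mx2 1 d' c' 1) Nmx)) =
  - normsq (d - d') / 2.
Proof.
apply: (mulfI (x := 2)); first by rewrite pnatr_eq0.
rewrite [RHS]mulrC divfK ?pnatr_eq0 //.
apply: (fmorph_inj (real_complex R)).
rewrite [LHS]mink_of_herm ?adj_hconj ?adj_Nmx // /hconj !adjmx2 !mx2M mx2D !det_mx2.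
have c1 : (1 : R[i])^*%C = 1 by exact: rmorph1.
have dE : (d - d')^*%C = d^*%C - d'^*%C by exact: rmorphB.
transitivity (- ((d - d') * (d - d')^*%C)); last by rewrite -normsqE -rmorphN.
by rewrite c1 dE; ring.
Qed.

Lemma mink_Nmx : mink (of_herm (Nmx : 'M[R[i]]_2)) (of_herm Nmx) = 0.
Proof.
apply: (mulfI (x := 2)); first by rewrite pnatr_eq0.
rewrite mulr0; apply: (fmorph_inj (real_complex R)).
by rewrite [LHS]mink_of_herm ?adj_Nmx // mx2D !det_mx2 rmorph0; ring.
Qed.

End Products.

(** * Rational identities on a quadrilateral *)

Section Quad.
Variable F : fieldType.

(** The cross-ratio equation gives [b] in terms of [a], which leaves an identity of rational
    functions. It serves for [psi] and for its conjugate, with [a] and [b] the two labels of a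
    face. *)
Lemma cross_ratio_sum (a b p1 p2 p3 p4 : F) :
  a != 0 -> b != 0 -> p2 - p1 != 0 -> p3 - p2 != 0 -> p4 - p3 != 0 -> p1 - p4 != 0 ->
  a * ((p2 - p1) * (p4 - p3)) = b * ((p3 - p2) * (p1 - p4)) ->
  (p1 + p2) / (a * (p2 - p1)) + (p2 + p3) / (b * (p3 - p2)) +
  (p3 + p4) / (a * (p4 - p3)) + (p4 + p1) / (b * (p1 - p4)) = 0.
Proof.
move=> a0 b0 d1 d2 d3 d4 cr.
have bE : b = a * ((p2 - p1) * (p4 - p3)) / ((p3 - p2) * (p1 - p4)).
  by rewrite cr; field; rewrite d2 d4.
by rewrite bE; field; rewrite d1 d2 d3 d4 a0.
Qed.

(** After solving the two relations for [n3] and [T3], the terms in T1 n2 and T2 n1 have numerators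
    equal, up to sign, to k1 k3 - k2 k4 = 0, and the terms in T2 n2 cancel. *)
Lemma quad_diag (k1 k2 k3 k4 n1 n2 n3 n4 T1 T2 T3 T4 y1 y2 y3 : F) :
  k2 - k3 != 0 -> k1 * k3 = k2 * k4 ->
  (k4 - k1) * n1 + (k1 - k2) * n2 + (k2 - k3) * n3 + (k3 - k4) * n4 = 0 ->
  (k4 - k1) * T1 + (k1 - k2) * T2 + (k2 - k3) * T3 + (k3 - k4) * T4 = 0 ->
  y2 = y1 + k1 * (T1 * n2 - T2 * n1) ->
  y3 = y2 + k2 * (T2 * n3 - T3 * n2) ->
  y3 - y1 = k2 * (k3 - k4) / (k2 - k3) * (T4 * n2 - T2 * n4).
Proof.
move=> c0 kk cn cT -> ->.
have nE : n3 = - ((k4 - k1) * n1 + (k1 - k2) * n2 + (k3 - k4) * n4) / (k2 - k3).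
  apply: (mulfI c0); rewrite mulrC [RHS]mulrC divfK //; apply/eqP.
  by rewrite -subr_eq0 -cn; apply/eqP; ring.
have TE : T3 = - ((k4 - k1) * T1 + (k1 - k2) * T2 + (k3 - k4) * T4) / (k2 - k3).
  apply: (mulfI c0); rewrite mulrC [RHS]mulrC divfK //; apply/eqP.
  by rewrite -subr_eq0 -cT; apply/eqP; ring.
rewrite nE TE {cn cT nE TE}.
by field: kk.
Qed.

End Quad.

(** * The lattice and the existence of the vertex signs *)

Section Lattice.

Lemma edgeP (i j : vertex) : edge i j ->
  [\/ j = (i.1 + 1, i.2), i = (j.1 + 1, j.2), j = (i.1, i.2 + 1) |
      i = (j.1, j.2 + 1)].
Proof.
case: i j => [a b] [c d]; rewrite /edge /= => h.
have [e|[e|[e|e]]] : (c = a + 1 /\ d = b) \/ (a = c + 1 /\ d = b) \/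
  (c = a /\ d = b + 1) \/ (a = c /\ b = d + 1) by lia.
- by apply: Or41; case: e => -> ->.
- by apply: Or42; case: e => -> ->.
- by apply: Or43; case: e => -> ->.
- by apply: Or44; case: e => -> ->.
Qed.

Lemma edge_sym (i j : vertex) : edge i j = edge j i.
Proof. by rewrite /edge distrC [X in _ + X]distrC. Qed.

Lemma face_rot (i j k l : vertex) : face i j k l -> face j k l i.
Proof.
by case/and5P=> ij jk kl li /andP[ik jl]; rewrite /face jk kl li ij jl eq_sym ik.
Qed.

Lemma face_unit (x y : int) : face (x, y) (x + 1, y) (x + 1, y + 1) (x, y + 1).
Proof.
rewrite /face /edge /= !xpair_eqE; lia.
Qed.

Lemma int_shift_const (T : Type) (f : int -> T) :
  (forall x, f (x + 1) = f x) -> forall x, f x = f 0.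
Proof.
move=> h; elim/int_ind => [//|n <-|n <-]; first by rewrite -(h n); congr f; lia.
by rewrite -[LHS]h; congr f; lia.
Qed.

Variable R : realType.

(** A multiplicative antiderivative: signs are their own inverses, so products of values of [A]
    starting from 0 work in both directions. *)
Lemma sign_primitive (A : int -> R) :
  (forall x, A x = 1 \/ A x = -1) ->
  exists P : int -> R, [/\ forall x, P x = 1 \/ P x = -1,
    forall x, P x * P (x + 1) = A x & (forall x, A x = 1) -> forall x, P x = 1].
Proof.
move=> hA.
have hprod n (f : nat -> int) :
    \prod_(k < n) A (f k) = 1 \/ \prod_(k < n) A (f k) = -1.
  elim: n => [|n IH]; first by rewrite big_ord0; left.
  rewrite big_ord_recr /=; case: IH => ->; case: (hA (f n)) => ->;
    rewrite ?mulr1 ?mulrNN ?mul1r; by [left | right].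
have sq (x : R) : x = 1 \/ x = -1 -> x * x = 1.
  by case=> ->; rewrite ?mulrNN mulr1.
(* [Negz n] is -(n + 1), hence [n.+1] factors on that side; at 0 the product is empty. *)
exists (fun x => match x with Posz n => \prod_(k < n) A k
                            | Negz n => \prod_(k < n.+1) A (Negz k) end).
split.
- by case=> n; [apply: (hprod n Posz) | apply: (hprod n.+1 Negz)].
- case=> n.
    have -> : Posz n + 1 = Posz n.+1 by lia.
    by rewrite big_ord_recr /= mulrA sq ?mul1r //; apply: (hprod n Posz).
  case: n => [|n].
    have -> : Negz 0 + 1 = Posz 0 by [].
    by rewrite big_ord_recl !big_ord0 !mulr1.
  rewrite (_ : Negz n.+1 + 1 = Negz n); last by lia.
  rewrite big_ord_recr /= mulrAC sq ?mul1r //; apply: (hprod n.+1 Negz).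
- by move=> h [] n; rewrite big1.
Qed.

(** Labels agree on opposite edges, so horizontal ones depend only on the first coordinate and
    vertical ones only on the second. A product of one primitive per coordinate therefore has the
    required edge signs. *)
Lemma edge_sign_exists (m : vertex -> vertex -> R) (lam : R) :
  edge_labelling m -> (forall i j, edge i j -> 1 - lam / m i j != 0) ->
  exists eps, edge_sign m lam eps.
Proof.
move=> [mE mF] q0.
pose A x := Num.sg (1 - lam / m (x, 0) (x + 1, 0)).
pose B y := Num.sg (1 - lam / m (0, y) (0, y + 1)).
have eh x y : edge (x, y) (x + 1, y) by rewrite /edge /=; lia.
have ev x y : edge (x, y) (x, y + 1) by rewrite /edge /=; lia.
have sgP (x : R) : x != 0 -> Num.sg x = 1 \/ Num.sg x = -1.
  by case: sgrP => // *; [left | right].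
have [P [P1 PA Ppos]] := sign_primitive (A := A) (fun x => sgP _ (q0 _ _ (eh x 0))).
have [Q [Q1 QB Qpos]] := sign_primitive (A := B) (fun y => sgP _ (q0 _ _ (ev 0 y))).
have mh x y : m (x, y) (x + 1, y) = m (x, 0) (x + 1, 0).
  apply: (int_shift_const (f := fun y => m (x, y) (x + 1, y))) => {}y.
  by have [-> _] := mF _ _ _ _ (face_unit x y).
have mv x y : m (x, y) (x, y + 1) = m (0, y) (0, y + 1).
  apply: (int_shift_const (f := fun x => m (x, y) (x, y + 1))) => {}x.
  by have [_ ->] := mF _ _ _ _ (face_unit x y).
have sq (x : R) : x = 1 \/ x = -1 -> x * x = 1.
  by case=> ->; rewrite ?mulrNN mulr1.
exists (fun i => P i.1 * Q i.2); split.
- move=> i; case: (P1 i.1) => ->; case: (Q1 i.2) => ->;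
    rewrite ?mulr1 ?mulrNN ?mul1r; by [left | right].
- have H x y : P x * Q y * (P (x + 1) * Q y) = Num.sg (1 - lam / m (x, y) (x + 1, y)).
    by rewrite mulrACA PA sq // mulr1 mh.
  have V x y : P x * Q y * (P x * Q (y + 1)) = Num.sg (1 - lam / m (x, y) (x, y + 1)).
    by rewrite mulrACA QB sq // mul1r mv.
  move=> [a b] [c d] e; have [_ ms] := mE _ _ e.
  case: (edgeP e) => -[] /= e1 e2; rewrite ?e1 ?e2 in ms *.
  + by rewrite H.
  + by rewrite [LHS]mulrC H -ms.
  + by rewrite V.
  + by rewrite [LHS]mulrC V -ms.
- move=> pos [x y] /=; rewrite Ppos ?Qpos ?mulr1 // => z; apply: gtr0_sg; exact: pos.
Qed.

End Lattice.

(** * Combinations of a pair with parallel edges and crosswise parallel diagonals *)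

Section ChristoffelPair.
Variable R : realType.
Variables (y g : surface R) (t : R).
Hypothesis yy : forall i, mink (y i) (y i) = - t.
Hypothesis yg : forall i, mink (y i) (g i) = - 1 / 2.
Hypothesis gg : forall i, mink (g i) (g i) = 0.
Hypothesis edge_yg : forall i j, edge i j ->
  exists a, y j - y i = a *: (g j - g i).
Hypothesis diag_yg : forall i j k l, face i j k l ->
  exists a, y k - y i = a *: (g j - g l).
Hypothesis planar_g : forall i j k l, face i j k l ->
  exists b c, g k - g i = b *: (g j - g i) + c *: (g l - g i).
Hypothesis prod_g : forall i j k l, face i j k l ->
  [/\ mink (g i) (g j) != 0, mink (g i) (g l) != 0 & mink (g j) (g l) != 0].

Let G i := <[g i]>%VS.
Let f s : surface R := fun i => s *: y i + (1 - s * t) *: g i.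

Lemma mink0r (u : mink_space R) : mink u 0 = 0.
Proof. by rewrite -(scale0r 0) minkZr mul0r. Qed.

Lemma gauss_neq0 i : g i != 0.
Proof.
apply: contra_eq_neq (yg i) => ->; rewrite mink0r eq_sym mulf_eq0 oppr_eq0.
by rewrite oner_eq0 invr_eq0 pnatr_eq0.
Qed.

(** The equations are the Gram system of three null vectors with pairwise products [p], [q], [r];
    its determinant is 2 p q r. *)
Lemma null3_coef (p q r a b c : R) : p != 0 -> q != 0 -> r != 0 ->
  b * p + c * q = 0 -> a * p + c * r = 0 -> a * q + b * r = 0 ->
  [/\ a = 0, b = 0 & c = 0].
Proof.
move=> p0 q0 r0 h1 h2 h3.
have c0 : c = 0.
  have : c * (2 * q * r) = 0.
    transitivity (0 * r + 0 * q - 0 * p); last by ring.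
    by rewrite -{1}h1 -{1}h2 -{1}h3; ring.
  by move/eqP; rewrite !mulf_eq0 pnatr_eq0 (negPf q0) (negPf r0) !orbF => /eqP.
rewrite c0 !mul0r !addr0 in h1 h2.
move/eqP: h1; move/eqP: h2; rewrite !mulf_eq0 (negPf p0) !orbF.
by move=> /eqP -> /eqP ->.
Qed.

Lemma free_null3 (u v w : mink_space R) :
  mink u u = 0 -> mink v v = 0 -> mink w w = 0 ->
  mink u v != 0 -> mink u w != 0 -> mink v w != 0 -> free [:: u; v; w].
Proof.
move=> uu vv ww uv uw vw; apply/freeP => k.
rewrite !big_ord_recl big_ord0 /= addr0 => sum0.
set a := k _ in sum0; set b := k _ in sum0; set c := k _ in sum0.
have P x : a * mink x u + (b * mink x v + c * mink x w) = 0.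
  by rewrite -!minkZr -!minkDr sum0 mink0r.
have Pu := P u; have Pv := P v; have Pw := P w.
rewrite uu mulr0 add0r in Pu; rewrite vv mulr0 add0r (minkC v u) in Pv.
rewrite ww mulr0 addr0 !(minkC w) in Pw.
have [a0 b0 c0] := null3_coef uv uw vw Pu Pv Pw.
case=> -[|[|[|//]]] h.
- by rewrite -[RHS]a0; congr k; apply/val_inj.
- by rewrite -[RHS]b0; congr k; apply/val_inj.
- by rewrite -[RHS]c0; congr k; apply/val_inj.
Qed.

(** A constant square makes the origin a centre for every face. For planarity, all differences from
    vertex [i] lie in the span of two edges of [g]. *)
Lemma circular_lin a b (r : R) :
  (forall i, mink (a *: y i + b *: g i) (a *: y i + b *: g i) = r) ->
  circular (fun i => a *: y i + b *: g i).
Proof.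
move=> hr; split; last by move=> i j k l _; exists 0, r => h _; rewrite subr0.
move=> i j k l F; have [ij jk kl li _] := and5P F.
rewrite edge_sym in li.
set U := <<[:: g j - g i; g l - g i]>>%VS.
have gj : g j - g i \in U by rewrite memv_span // inE eqxx.
have gl : g l - g i \in U by rewrite memv_span // !inE eqxx orbT.
suff sub : (<<[:: a *: y j + b *: g j - (a *: y i + b *: g i);
    a *: y k + b *: g k - (a *: y i + b *: g i);
    a *: y l + b *: g l - (a *: y i + b *: g i)]>> <= U)%VS.
  by apply: leq_trans (dimvS sub) _; exact: dim_span.
have mem h : y h - y i \in U -> g h - g i \in U ->
    a *: y h + b *: g h - (a *: y i + b *: g i) \in U.
  by move=> hy hg; rewrite opprD addrACA -!scalerBr memvD ?memvZ.
apply/span_subvP => v; rewrite !inE => /or3P[] /eqP ->; apply: mem => //.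
- by have [c ->] := edge_yg ij; rewrite memvZ.
- have [c ->] := diag_yg F; rewrite memvZ //.
  have -> : g j - g l = (g j - g i) - (g l - g i) by rewrite opprB addrA subrK.
  by rewrite memvB.
- by have [b' [c ->]] := planar_g F; rewrite memvD ?memvZ.
- by have [c ->] := edge_yg li; rewrite memvZ.
Qed.

(** On each face three of the four lines are already independent, by [free_null3]. *)
Lemma lightlike_line_span : lightlike_gauss_map G.
Proof.
split=> [i|i j k l F].
  split; first by rewrite dim_vline gauss_neq0.
  by move=> v /vlineP[a ->]; rewrite minkZl minkZr gg !mulr0.
have [p1 p2 p3] := prod_g F.
have fr := free_null3 (gg i) (gg j) (gg l) p1 p2 p3.
apply: (@leq_trans (\dim <<[:: g i; g j; g l]>>)); first by rewrite (eqP fr).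
apply: dimvS; apply/span_subvP => v; rewrite !inE.
have mem h : g h \in G h by exact: memv_line.
case/or3P=> /eqP ->.
- by do 3![apply: (subvP (addvSl _ _))]; exact: mem.
- by do 2![apply: (subvP (addvSl _ _))]; apply: (subvP (addvSr _ _)); exact: mem.
- by apply: (subvP (addvSr _ _)); exact: mem.
Qed.

Lemma legendre_span s : legendre_immersion (f s) G.
Proof.
split=> [|i j e]; first exact: lightlike_line_span.
have [a ya] := edge_yg e.
(* This is the factor in f_j - f_i = c (g_j - g_i), so f_i - c g_i = f_j - c g_j lies on both
   lines. *)
pose c := s * a + (1 - s * t).
exists (f s i - c *: g i); rewrite !inE /affine_line; split.
  by rewrite addrC addKr memvN memvZ ?memv_line.
have fE : f s j - f s i = c *: (g j - g i).
  by rewrite /f /c opprD addrACA -!scalerBr ya scalerA -scalerDl.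
have -> : f s i - c *: g i - f s j = - (c *: g j).
  by rewrite addrAC -(opprB (f s j) (f s i)) fE scalerBr opprB addrAC subrr add0r.
by rewrite memvN memvZ ?memv_line.
Qed.

Lemma gauss_section_span : gauss_section G g.
Proof. by move=> i; rewrite gauss_neq0. Qed.

Lemma wedgeZl a (u v : mink_space R) : wedge (a *: u) v = a *: wedge u v.
Proof. by apply/matrixP => p q; rewrite !mxE !big_ord1 !mxE; ring. Qed.

Lemma wedgeZr a (u v : mink_space R) : wedge u (a *: v) = a *: wedge u v.
Proof. by apply/matrixP => p q; rewrite !mxE !big_ord1 !mxE; ring. Qed.

Lemma wedgeDl (u v w : mink_space R) : wedge (u + v) w = wedge u w + wedge v w.
Proof. by apply/matrixP => p q; rewrite !mxE !big_ord1 !mxE; ring. Qed.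

Lemma wedgeC (u v : mink_space R) : wedge u v = - wedge v u.
Proof. by rewrite /wedge opprB. Qed.

Lemma wedgeDr (u v w : mink_space R) : wedge u (v + w) = wedge u v + wedge u w.
Proof. by rewrite wedgeC wedgeDl opprD -!wedgeC. Qed.

Lemma wedge_uu (u : mink_space R) : wedge u u = 0.
Proof. exact: subrr. Qed.

(* The diagonals of [y] are parallel to the opposite diagonals of [g]. *)
Lemma mixed_area_lin i j k l : face i j k l -> exists r : R, forall a b c d : R,
  mixed_area (fun i => a *: y i + b *: g i) (fun i => c *: y i + d *: g i) i j k l =
  (a * c * r + b * d) *: mixed_area g g i j k l.
Proof.
move=> F; have [p yp] := diag_yg F; have [q yq] := diag_yg (face_rot F).
(* The cross terms A(y,g) wedge parallel vectors and vanish, while A(y,y) = p q A(g,g). *)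
exists (p * q) => a b c d; rewrite /mixed_area.
have diff (a' b' : R) h h' : a' *: y h + b' *: g h - (a' *: y h' + b' *: g h') =
    a' *: (y h - y h') + b' *: (g h - g h').
  by rewrite opprD addrACA -!scalerBr.
rewrite !diff -(opprB (y k) (y i)) yp -(opprB (y l) (y j)) yq -(opprB (g i) (g k)).
move: (g i - g k) (g j - g l) => u v.
rewrite scalerA mulrC -scalerA; congr (_ *: _).
rewrite -!scaleN1r !(wedgeDl, wedgeDr, wedgeZl, wedgeZr) !wedge_uu (wedgeC v u).
apply/matrixP => r r'; rewrite !mxE; ring.
Qed.

(** The coefficients 0 and 1 are kept so that [circular_lin] and [mixed_area_lin] apply to both
    maps. *)
Lemma christoffel_dual_span s :
  christoffel_dual (fun i => s *: y i + 0 *: g i) (fun i => 0 *: y i + 1 *: g i).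
Proof.
split.
- move=> i j e; have [a ya] := edge_yg (etrans (edge_sym j i) e).
  rewrite /parallel !scale0r !addr0 !add0r !scale1r -scalerBr ya scalerA.
  apply: (@leq_trans (\dim <[g i - g j]>)); last by rewrite dim_vline leq_b1.
  apply/dimvS/span_subvP => v; rewrite !inE => /orP[] /eqP ->.
    by rewrite memvZ // memv_line.
  exact: memv_line.
- apply: (circular_lin (r := s * s * - t)) => i.
  by rewrite scale0r addr0 minkZl minkZr yy mulrA.
- apply: (circular_lin (r := 0)) => i.
  by rewrite scale0r add0r scale1r gg.
- move=> i j k l F; have [r ->] := mixed_area_lin F.
  by rewrite mulr0 !mul0r addr0 scale0r.
Qed.

Lemma omega_dual_span s : omega_dual (f s) G.
Proof.
split; first exact: legendre_span.
(* Since s y = f^s - (1 - s t) g, the surface s y is a section of f^s + G. *)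
exists (fun i => s *: y i + 0 *: g i), (fun i => 0 *: y i + 1 *: g i); split.
- move=> i; rewrite inE /f scale0r addr0 opprD addNKr memvN memvZ //.
  exact: memv_line.
- by move=> i; rewrite scale0r add0r scale1r; exact: gauss_section_span.
- exact: christoffel_dual_span.
Qed.

Lemma mink_span_gauss s i : mink (f s i) (g i) = - s / 2.
Proof. by rewrite minkDl !minkZl yg gg; ring. Qed.

Lemma mink_span s i : s * s = 1 -> mink (f s i) (f s i) = - s.
Proof.
move=> ss; rewrite {2}/f minkDr !minkZr mink_span_gauss minkDl !minkZl yy (minkC (g i)) yg.
transitivity (- t * (s * s) - s + t * (s * s)); last by rewrite ss; ring.
by field.
Qed.

Lemma mixed_area_ext x x' z z' i j k l : x =1 x' -> z =1 z' ->
  mixed_area x z i j k l = mixed_area x' z' i j k l :> 'M[R]_4.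
Proof. by move=> xE zE; rewrite /mixed_area !xE !zE. Qed.

Lemma gauss_section_scale h i : gauss_section G h ->
  exists2 c, c != 0 & h i = c *: g i.
Proof.
move=> /(_ i)[h0 hG]; have : h i \in <[g i]>%VS by rewrite -/(G i) -hG memv_line.
move=> /vlineP[c hc]; exists c => //.
by apply: contraNneq h0 => c0; rewrite hc c0 scale0r.
Qed.

(** The normal is independent of the scale of the section, and (f^s, g) = - s / 2 turns it into 2 g
    - f^s. *)
Lemma gauss_normal_span s h : s * s = 1 -> gauss_section G h ->
  gauss_normal s (f s) h =1 (fun i => (- s) *: y i + (1 + s * t) *: g i).
Proof.
move=> ss hG i; have [c c0 hc] := gauss_section_scale i hG.
have s0 : s != 0 by apply: contra_eq_neq ss => ->; rewrite mul0r eq_sym oner_eq0.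
rewrite /gauss_normal hc minkZl minkC mink_span_gauss scalerA.
have -> : - (s / (c * (- s / 2))) * c = 2 by field; rewrite s0 c0.
by rewrite /f opprD addrCA -scaleNr -scaleNr -scalerDl; congr (_ + _ *: _); ring.
Qed.

Lemma linear_weingarten_span s : s * s = 1 -> regular_surface (f s) ->
  linear_weingarten s (f s) G.
Proof.
move=> ss reg.
have s0 : s != 0 by apply: contra_eq_neq ss => ->; rewrite mul0r eq_sym oner_eq0.
split.
- by move=> i; apply: mink_span.
- by split=> //; apply: (circular_lin (r := - s)) => i; apply: mink_span.
- exact: legendre_span.
- move=> h hG i; have [c c0 ->] := gauss_section_scale i hG.
  by rewrite minkZr mink_span_gauss !mulf_neq0 ?oppr_eq0 ?invr_eq0 ?pnatr_eq0.
exists (- t) => h hG i j k l F; have [r area] := mixed_area_lin F.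
have nE := gauss_normal_span ss hG.
have := reg _ _ _ _ F.
rewrite !(mixed_area_ext _ _ _ _ (frefl (f s)) nE) (mixed_area_ext _ _ _ _ nE nE).
rewrite !area; set D := s * s * r + _; rewrite scaler_eq0 negb_or => /andP[D0 _].
(* All three mixed areas are multiples of A(g,g), so [H] and [K] are quotients of the coefficients.
   [D] belongs to A(f,f) and is nonzero by regularity. *)
exists ((s * s * r - (1 - s * t) * (1 + s * t)) / D),
  ((s * s * r + (1 + s * t) * (1 + s * t)) / D); split.
- rewrite scalerA divfK // -scalerDl -[RHS](scale0r (mixed_area g g i j k l)).
  by congr (_ *: _); ring.
- by rewrite scalerA divfK // mulrNN subrr.
(* For mu = - t the terms in [r] cancel, and the rest vanishes by s^2 = 1. *)
by rewrite /D in D0 *; field: ss.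
Qed.

End ChristoffelPair.

(** * The frame [E] and its edge identity *)

Section Representation.
Variable R : realType.
Variables (m : vertex -> vertex -> R) (psi : vertex -> R[i]).
Variables (lam : R) (sg : vertex -> vertex -> R[i]) (E : vertex -> 'M[R[i]]_2).
Variable eps : vertex -> R.
Hypothesis holo : discrete_holomorphic m psi.
Hypothesis lam0 : lam != 0.
Hypothesis q0 : forall i j, edge i j -> 1 - lam / m i j != 0.
Hypothesis sqrts : edge_sqrt m lam sg.
Hypothesis detE : forall i, \det (E i) = 1.
Hypothesis stepE : forall i j, edge i j ->
  invmx (E i) *m E j = transition m lam sg psi i j.
Hypothesis epsP : edge_sign m lam eps.

Lemma m_neq0 i j : edge i j -> m i j != 0.
Proof. by case: holo => -[h _] _ /h[]. Qed.

Lemma m_sym i j : edge i j -> m i j = m j i.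
Proof. by case: holo => -[h _] _ /h[]. Qed.

Lemma unitE i : E i \in unitmx.
Proof. by rewrite unitmxE detE unitr1. Qed.

Lemma E_step i j : edge i j -> E j = E i *m transition m lam sg psi i j.
Proof. by move=> /stepE <-; rewrite mulKVmx ?unitE. Qed.

(** For a zero difference the quotient in [transition] would be 0 by the convention on division. Its
    determinant would then be 1 / (1 - lam / m_ij), which is 1 only for lam = 0. *)
Lemma edge_psi i j : edge i j -> psi j - psi i != 0.
Proof.
move=> e; apply: contraNneq lam0 => d0.
have := detE j; rewrite (E_step e) det_mulmx detE mul1r /transition d0 mx2Z det_mx2.
rewrite mulr0 !mulr1 mulr0 mul0r subr0 -expr2 exprVn.
have [-> _] := sqrts.1 _ _ e => /(congr1 GRing.inv); rewrite invrK invr1 => /eqP.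
rewrite -(rmorph1 (real_complex R)) (inj_eq (fmorph_inj _)) subr_eq -[X in X == _]addr0.
by rewrite (inj_eq (addrI _)) eq_sym mulf_eq0 invr_eq0 (negPf (m_neq0 e)) orbF.
Qed.

Definition frame_vec A : surface R := fun i => eps i *: of_herm (hconj (E i) A).

Definition trans1 i j : 'M[R[i]]_2 :=
  mx2 1 (psi j - psi i) (lam%:C / ((m i j)%:C * (psi j - psi i))) 1.

(* [eps] turns the factor 1 / |1 - lam / m_ij| of B |-> B B^* into
   1 / (1 - lam / m_ij). *)
Lemma frame_step A i j : edge i j -> frame_vec A j =
  eps i *: of_herm (hconj (E i) (((1 - lam / m i j)^-1)%:C *: hconj (trans1 i j) A)).
Proof.
move=> e; have [eps1 epsE _] := epsP.
rewrite /frame_vec (E_step e) hconjM /transition hconj_scale -/(trans1 i j).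
have [sq _] := sqrts.1 _ _ e; have q := q0 e; have {epsE} eE := epsE _ _ e.
move: (1 - lam / m i j) q sq eE => q q1 sq eE.
have sE : sg i j * (sg i j)^*%C = (Num.sg q * q)%:C.
  by rewrite (conj_sqrt sq) mulrCA -expr2 sq rmorphM.
have -> : (sg i j)^-1 * (sg i j)^-1^*%C = ((Num.sg q * q)^-1)%:C.
  by rewrite [X in _ * X]fmorphV -invfM [RHS]fmorphV /= -sE mulrC.
rewrite !hconjZ !of_hermZ !scalerA; congr (_ *: _).
have -> : eps j = eps i * Num.sg q.
  by rewrite -eE mulrA; case: (eps1 i) => ->; rewrite ?mulrNN !mul1r.
have s0 : Num.sg q != 0 by rewrite sgr_eq0.
by field; rewrite s0 q1.
Qed.

Definition ypt t : surface R := fun i => frame_vec (Ymx t (psi i)) i.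
Definition npt : surface R := frame_vec Nmx.
Definition kpt i j : R := kcoef lam (m i j) (psi j - psi i).

(** This is [hconj_transition] carried over by the action of [E i]. *)
Lemma ypt_step t i j : edge i j -> ypt t j = ypt t i +
  kpt i j *: (Tval t (psi i) *: npt j - Tval t (psi j) *: npt i).
Proof.
move=> e; rewrite /npt /ypt (frame_step _ e) hconj_transition ?m_neq0 ?edge_psi ?q0 //.
rewrite (frame_step _ e) /frame_vec hconjD of_hermD scalerDr; congr (_ + _).
have lin (a k x z : R) (u v : mink_space R) :
    a *: (k *: (x *: u - z *: v)) = k *: (x *: (a *: u) - z *: (a *: v)).
  by apply/rowP => n; rewrite !mxE; ring.
rewrite hconjZ of_hermZ -/(kpt i j) hconjD of_hermD hconjN of_hermN.
move: (_ *: hconj _ _) => W.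
by rewrite (of_herm_hconjZ _ (Tval t (psi i))) (of_herm_hconjZ _ (Tval t (psi j))) lin.
Qed.

(** * Consequences of the cross-ratio condition on a face *)

Lemma face_m i j k l : face i j k l ->
  [/\ m k l = m i j, m l i = m j k & m j k / m i j < 0].
Proof.
move=> f; have [ij jk kl li _] := and5P f.
have [[_ mF] H] := holo; have [e1 e2] := mF _ _ _ _ f; have [_] := H _ _ _ _ f.
by rewrite (m_sym kl) -e1 (m_sym li) e2.
Qed.

Lemma face_cross i j k l : face i j k l ->
  (m i j)%:C * ((psi j - psi i) * (psi l - psi k)) =
  (m j k)%:C * ((psi k - psi j) * (psi i - psi l)).
Proof.
move=> f; have [ij jk kl li _] := and5P f.
have [[_ mF] H] := holo; have [_ e2] := mF _ _ _ _ f.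
have [] := H _ _ _ _ f; rewrite e2 fmorph_div /= => cr _.
have mC : (m i j)%:C != 0 by rewrite fmorph_eq0 m_neq0.
have -> : (m j k)%:C = (m i j)%:C * ((m j k)%:C / (m i j)%:C) by field.
rewrite -cr; have d2 := edge_psi jk; have d4 := edge_psi li.
by field; rewrite -[psi j - _]opprB -[psi l - _]opprB !oppr_eq0 d2 d4.
Qed.

(** If the two values agreed, [face_cross] would reduce to m_ij = m_jk, against the negative sign of
    the cross-ratio. *)
Lemma face_psi_diag i j k l : face i j k l -> psi j - psi l != 0.
Proof.
move=> f; have [ij jk kl li _] := and5P f; have [_ _ neg] := face_m f.
apply: contraTneq neg => /eqP; rewrite subr_eq0 => /eqP jl.
have := face_cross f; rewrite jl.
have d1 := edge_psi ij; have d2 := edge_psi jk; rewrite jl in d1 d2.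
move=> /eqP; rewrite -subr_eq0.
have -> : (m i j)%:C * ((psi l - psi i) * (psi l - psi k)) -
    (m j k)%:C * ((psi k - psi l) * (psi i - psi l)) =
    ((m j k)%:C - (m i j)%:C) * ((psi l - psi i) * (psi k - psi l)) by ring.
rewrite !mulf_eq0 (negPf d1) (negPf d2) !orbF subr_eq0.
rewrite (inj_eq (fmorph_inj (real_complex R))) => /eqP ->.
by rewrite divff ?m_neq0 // ltr10.
Qed.

Lemma kptE i j : (kpt i j)%:C =
  lam%:C / ((m i j)%:C * ((psi j - psi i) * ((psi j)^*%C - (psi i)^*%C))).
Proof. by rewrite [LHS]kcoefE rmorphB. Qed.

Lemma face_cross_conj i j k l : face i j k l ->
  (m i j)%:C * (((psi j)^*%C - (psi i)^*%C) * ((psi l)^*%C - (psi k)^*%C)) =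
  (m j k)%:C * (((psi k)^*%C - (psi j)^*%C) * ((psi i)^*%C - (psi l)^*%C)).
Proof.
move=> f; have := congr1 conjc (face_cross f).
by rewrite !rmorphM !rmorphB /= !oppr0.
Qed.

Lemma edge_psi_conj i j : edge i j -> (psi j)^*%C - (psi i)^*%C != 0.
Proof. by move=> e; rewrite -rmorphB conjC_eq0 edge_psi. Qed.

(** Multiply the cross-ratio equation by its conjugate. *)
Lemma face_kprod i j k l : face i j k l ->
  kpt i j * kpt k l = kpt j k * kpt l i.
Proof.
move=> f; have [ij jk kl li _] := and5P f; have [m3 m4 _] := face_m f.
have mi : (m i j)%:C != 0 by rewrite fmorph_eq0 m_neq0.
have mj : (m j k)%:C != 0 by rewrite fmorph_eq0 m_neq0.
have fold a b c d e : lam%:C / (a * (b * c)) * (lam%:C / (a * (d * e))) =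
    lam%:C ^+ 2 / ((a * (b * d)) * (a * (c * e))) :> R[i].
  by rewrite mulf_div; congr (_ / _); ring.
apply: (fmorph_inj (real_complex R)).
rewrite (rmorphM _ (kpt i j)) (rmorphM _ (kpt j k)) /= !kptE m3 m4.
by rewrite !fold // (face_cross f) (face_cross_conj f).
Qed.

(** Equality would make m_jk / m_ij a quotient of squared lengths, hence not negative. *)
Lemma kpt_diff i j k l : face i j k l -> kpt j k - kpt k l != 0.
Proof.
move=> f; have [ij jk kl li _] := and5P f; have [m3 _ neg] := face_m f.
apply: contraTneq neg => /eqP; rewrite subr_eq0 /kpt /kcoef m3 => /eqP.
have n2 : 0 < normsq (psi k - psi j) by rewrite lt0r normsq_eq0 edge_psi // addr_ge0 ?sqr_ge0.
have n3 : 0 < normsq (psi l - psi k) by rewrite lt0r normsq_eq0 edge_psi // addr_ge0 ?sqr_ge0.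
move/(mulfI lam0)/invr_inj => e.
have -> : m j k / m i j = normsq (psi l - psi k) / normsq (psi k - psi j).
  apply: (mulIf (lt0r_neq0 n2)); rewrite mulrAC e divfK ?lt0r_neq0 //.
  by rewrite mulrC mulKf ?m_neq0.
by rewrite -leNgt divr_ge0 ?ltW.
Qed.

(** [npt] does not depend on [t], so the edge identity may be used at t = 0, where all T are 1, and
    summed around the face. *)
Lemma face_closure_npt i j k l : face i j k l ->
  (kpt l i - kpt i j) *: npt i + (kpt i j - kpt j k) *: npt j +
  (kpt j k - kpt k l) *: npt k + (kpt k l - kpt l i) *: npt l = 0.
Proof.
move=> f; have [ij jk kl li _] := and5P f.
have T0 p : Tval 0 p = 1 by rewrite /Tval mul0r addr0.
have h1 := ypt_step 0 ij; have h2 := ypt_step 0 jk; have h3 := ypt_step 0 kl.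
have h4 := ypt_step 0 li; rewrite !T0 in h1 h2 h3 h4.
move: (kpt i j) (kpt j k) (kpt k l) (kpt l i) h1 h2 h3 h4 => k1 k2 k3 k4.
move: (ypt 0 i) (ypt 0 j) (ypt 0 k) (ypt 0 l) => y1 y2 y3 y4.
move: (npt i) (npt j) (npt k) (npt l) => n1 n2 n3 n4 -> -> -> /rowP H.
apply/rowP => n; have := H n; rewrite !mxE => {}H.
by apply/eqP; rewrite -(subrr (y1 0 n)) [X in _ == X - _]H; apply/eqP; ring.
Qed.

(** The coefficients sum to 0, so only the part of T in |psi|^2 counts. Summation by parts reduces
    it to [cross_ratio_sum] for [psi] plus the same for its conjugate. *)
Lemma face_closure_Tval t i j k l : face i j k l ->
  (kpt l i - kpt i j) * Tval t (psi i) + (kpt i j - kpt j k) * Tval t (psi j) +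
  (kpt j k - kpt k l) * Tval t (psi k) + (kpt k l - kpt l i) * Tval t (psi l) = 0.
Proof.
move=> f; have [ij jk kl li _] := and5P f; have [m3 m4 _] := face_m f.
have cr := face_cross f; have cr' := face_cross_conj f.
have d1 := edge_psi ij; have d2 := edge_psi jk; have d3 := edge_psi kl.
have d4 := edge_psi li; have d1' := edge_psi_conj ij; have d2' := edge_psi_conj jk.
have d3' := edge_psi_conj kl; have d4' := edge_psi_conj li.
have mi : (m i j)%:C != 0 by rewrite fmorph_eq0 m_neq0.
have mj : (m j k)%:C != 0 by rewrite fmorph_eq0 m_neq0.
have S := cross_ratio_sum mi mj d1 d2 d3 d4 cr.
have S' := cross_ratio_sum mi mj d1' d2' d3' d4' cr'.
(* This uses 2 (q q' - p p') = (p + q) (q' - p') + (p' + q') (q - p), which separates [psi] from its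
   conjugate. *)
have term (a p q p' q' : R[i]) : a != 0 -> q - p != 0 -> q' - p' != 0 ->
    lam%:C / (a * ((q - p) * (q' - p'))) * (q * q' - p * p') =
    lam%:C / 2 * ((p + q) / (a * (q - p)) + (p' + q') / (a * (q' - p'))).
  by move=> a0 p0 p0'; field; rewrite a0 p0 p0'.
have T1 := term _ _ _ _ _ mi d1 d1'; have T2 := term _ _ _ _ _ mj d2 d2'.
have T3 := term _ _ _ _ _ mi d3 d3'; have T4 := term _ _ _ _ _ mj d4 d4'.
have e1 := kptE i j; have e2 := kptE j k; have e3 := kptE k l; have e4 := kptE l i.
rewrite m3 in e3; rewrite m4 in e4; rewrite -e1 in T1; rewrite -e2 in T2.
rewrite -e3 in T3; rewrite -e4 in T4.
have n1 := normsqE (psi i); have n2 := normsqE (psi j).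
have n3 := normsqE (psi k); have n4 := normsqE (psi l).
rewrite -n1 -n2 in T1; rewrite -n2 -n3 in T2; rewrite -n3 -n4 in T3.
rewrite -n4 -n1 in T4; rewrite /Tval {n1 n2 n3 n4 e1 e2 e3 e4}.
move: (kpt i j) (kpt j k) (kpt k l) (kpt l i) T1 T2 T3 T4 => k1 k2 k3 k4.
move: (normsq (psi i)) (normsq (psi j)) (normsq (psi k)) (normsq (psi l)).
move=> n1 n2 n3 n4 T1 T2 T3 T4.
have key : k1 * (n2 - n1) + k2 * (n3 - n2) + k3 * (n4 - n3) + k4 * (n1 - n4) = 0.
  apply: (fmorph_inj (real_complex R)).
  rewrite !rmorphD !rmorphM !rmorphB rmorph0 /= T1 T2 T3 T4.
  transitivity (lam%:C / 2 * (0 + 0 : R[i])); last by rewrite addr0 mulr0.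
  by rewrite -{1}S -S'; ring.
by rewrite -(mulr0 t) -key; ring.
Qed.

(** Lets the vector at the base vertex enter [mink_Nmx_conj] with d = 0. *)
Lemma hconj1_Nmx : hconj (mx2 1 0 0 1) Nmx = Nmx :> 'M[R[i]]_2.
Proof.
have c0 : conjc (0 : R[i]) = 0 by exact: rmorph0.
have c1 : conjc (1 : R[i]) = 1 by exact: rmorph1.
by rewrite /hconj adjmx2 !mx2M c0 c1 !(mulr0, mul0r, mulr1, addr0, add0r).
Qed.

Lemma eps_sqr i : eps i * eps i = 1.
Proof. by case: epsP => h _ _; case: (h i) => ->; rewrite ?mulrNN mulr1. Qed.

Lemma mink_frame A B i : adjmx A = A -> adjmx B = B ->
  mink (frame_vec A i) (frame_vec B i) = mink (of_herm A) (of_herm B).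
Proof. by move=> hA hB; rewrite minkZl minkZr mulrA eps_sqr mul1r mink_hconj. Qed.

Lemma npt_step i j : edge i j -> npt j =
  (eps i * (1 - lam / m i j)^-1) *: of_herm (hconj (E i) (hconj (trans1 i j) Nmx)).
Proof. by move=> e; rewrite /npt (frame_step _ e) of_herm_hconjZ scalerA. Qed.

Lemma npt_coef_neq0 i j : edge i j -> eps i * (1 - lam / m i j)^-1 != 0.
Proof.
move=> e; rewrite mulf_neq0 ?invr_eq0 ?q0 //.
by apply: contra_eq_neq (eps_sqr i) => ->; rewrite mul0r eq_sym oner_eq0.
Qed.

Lemma mink_npt_edge i j : edge i j -> mink (npt i) (npt j) != 0.
Proof.
move=> e; rewrite (npt_step e) minkZr mulf_neq0 ?npt_coef_neq0 //.
rewrite /npt /frame_vec -[X in hconj _ X]hconj1_Nmx minkZl.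
rewrite mink_hconj ?adj_hconj ?adj_Nmx // mink_Nmx_conj sub0r.
rewrite !mulf_neq0 ?invr_eq0 ?oppr_eq0 ?normsq_eq0 ?oppr_eq0 ?edge_psi ?pnatr_eq0 //.
by apply: contra_eq_neq (eps_sqr i) => ->; rewrite mul0r eq_sym oner_eq0.
Qed.

(** Both vectors are expressed in the frame of the common neighbour [i], where [mink_Nmx_conj]
    applies. *)
Lemma mink_npt_diag i j l : edge i j -> edge i l -> psi j - psi l != 0 ->
  mink (npt j) (npt l) != 0.
Proof.
move=> e e' d0; rewrite (npt_step e) (npt_step e') minkZl minkZr.
rewrite mulf_neq0 ?npt_coef_neq0 // mulf_neq0 ?npt_coef_neq0 //.
rewrite mink_hconj ?adj_hconj ?adj_Nmx // mink_Nmx_conj opprB addrA subrK.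
by rewrite mulf_neq0 ?invr_eq0 ?oppr_eq0 ?normsq_eq0 ?pnatr_eq0.
Qed.

(** * The pair y, g built from the frame, and the representation *)

Variable t : R.
Hypothesis T0 : forall i, Tval t (psi i) != 0.

Definition gpt : surface R := fun i => (Tval t (psi i))^-1 *: npt i.

Lemma nptE i : npt i = Tval t (psi i) *: gpt i.
Proof. by rewrite scalerA divff ?scale1r. Qed.

Lemma mink_gpt_neq0 i j : mink (npt i) (npt j) != 0 -> mink (gpt i) (gpt j) != 0.
Proof. by move=> h; rewrite minkZl minkZr !mulf_neq0 ?invr_eq0. Qed.

Lemma mink_ypt i : mink (ypt t i) (ypt t i) = - t.
Proof. by rewrite mink_frame ?adj_Ymx // mink_Ymx. Qed.

Lemma mink_ypt_gpt i : mink (ypt t i) (gpt i) = - 1 / 2.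
Proof.
rewrite minkZr mink_frame ?adj_Ymx ?adj_Nmx // mink_YN.
by field; rewrite T0.
Qed.

Lemma mink_gpt i : mink (gpt i) (gpt i) = 0.
Proof. by rewrite minkZr minkZl mink_frame ?adj_Nmx // mink_Nmx !mulr0. Qed.

Lemma edge_ypt_gpt i j : edge i j -> exists a, ypt t j - ypt t i = a *: (gpt j - gpt i).
Proof.
move=> e; exists (kpt i j * (Tval t (psi i) * Tval t (psi j))).
rewrite (ypt_step t e) addrC addKr !nptE; move: (gpt i) (gpt j) => u v.
by apply/rowP => n; rewrite !mxE; ring.
Qed.

Lemma diag_ypt_gpt i j k l : face i j k l ->
  exists a, ypt t k - ypt t i = a *: (gpt j - gpt l).
Proof.
move=> f; have [ij jk kl li _] := and5P f.
(* The coefficient of [quad_diag]; the factor T_l T_j passes from [npt] to [gpt]. *)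
exists (kpt j k * (kpt k l - kpt l i) / (kpt j k - kpt k l) *
  (Tval t (psi l) * Tval t (psi j))).
have yj := ypt_step t ij; have yk := ypt_step t jk.
have cn := face_closure_npt f; have cT := face_closure_Tval t f.
have c0 := kpt_diff f; have kk := face_kprod f.
transitivity ((kpt j k * (kpt k l - kpt l i) / (kpt j k - kpt k l)) *:
    (Tval t (psi l) *: npt j - Tval t (psi j) *: npt l)); last first.
  rewrite !nptE; move: (gpt j) (gpt l) => u v.
  by apply/rowP => n; rewrite !mxE; ring.
move: (kpt i j) (kpt j k) (kpt k l) (kpt l i) yj yk cn cT c0 kk => k1 k2 k3 k4.
move: (npt i) (npt j) (npt k) (npt l) (ypt t i) (ypt t j) (ypt t k).
move=> n1 n2 n3 n4 y1 y2 y3 yj yk /rowP cn cT c0 kk.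
apply/rowP => n; rewrite !mxE.
apply: (quad_diag (n1 := n1 0 n) (n3 := n3 0 n) (y2 := y2 0 n) c0 kk _ cT).
- by have := cn n; rewrite !mxE.
- by rewrite yj !mxE.
- by rewrite yk !mxE.
Qed.

(** Written in terms of [gpt], the relation [face_closure_npt] has coefficients with sum 0 by
    [face_closure_Tval]. It is therefore an affine relation, which can be solved for vertex [k]. *)
Lemma planar_gpt i j k l : face i j k l ->
  exists b c, gpt k - gpt i = b *: (gpt j - gpt i) + c *: (gpt l - gpt i).
Proof.
move=> f; have c0 := kpt_diff f.
have cn := face_closure_npt f; have cT := face_closure_Tval t f.
have c3 : (kpt j k - kpt k l) * Tval t (psi k) != 0 by rewrite mulf_neq0.
exists (- ((kpt i j - kpt j k) * Tval t (psi j)) / ((kpt j k - kpt k l) * Tval t (psi k))),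
  (- ((kpt k l - kpt l i) * Tval t (psi l)) / ((kpt j k - kpt k l) * Tval t (psi k))).
rewrite !nptE in cn; move: (gpt i) (gpt j) (gpt k) (gpt l) cn => u1 u2 u3 u4 /rowP cn.
apply/rowP => n; have := cn n; rewrite !mxE !mulrA.
move: (u1 0 n) (u2 0 n) (u3 0 n) (u4 0 n) => g1 g2 g3 g4.
move: cT c3; set a1 := (_ - _) * Tval _ (psi i); set a2 := (_ - _) * Tval _ (psi j).
set a3 := (_ - _) * Tval _ (psi k); set a4 := (_ - _) * Tval _ (psi l).
move: a1 a2 a3 a4 => a1 a2 a3 a4 cT c3 cg.
have -> : g3 = - (a1 * g1 + a2 * g2 + a4 * g4) / a3.
  apply: (mulfI c3); rewrite [RHS]mulrC divfK //.
  by apply/eqP; rewrite -subr_eq0 -cg; apply/eqP; ring.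
have -> : a1 = - (a2 + a3 + a4) by apply/eqP; rewrite -subr_eq0 -cT; apply/eqP; ring.
by field.
Qed.

Lemma prod_gpt i j k l : face i j k l ->
  [/\ mink (gpt i) (gpt j) != 0, mink (gpt i) (gpt l) != 0 &
      mink (gpt j) (gpt l) != 0].
Proof.
move=> f; have [ij jk kl li _] := and5P f; rewrite edge_sym in li.
split; apply: mink_gpt_neq0; [exact: mink_npt_edge | exact: mink_npt_edge |].
exact: (mink_npt_diag ij li (face_psi_diag f)).
Qed.

Lemma weierstrass_span s i : eps i *: weierstrass s t psi E i =
  s *: ypt t i + (1 - s * t) *: gpt i.
Proof.
rewrite weierstrassE; last exact: T0.
have lin (a c x : R) (u v : mink_space R) :
    a *: (s *: u + (c / x) *: v) = s *: (a *: u) + c *: (x^-1 *: (a *: v)).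
  by apply/rowP => n; rewrite !mxE; ring.
exact: lin.
Qed.

(** The lines [G] do not involve [s], so both surfaces share one Gauss map. *)
Lemma representation_omega_dual s : s * s = 1 ->
  let x : surface R := fun i => eps i *: weierstrass s t psi E i in
  let G := fun i => <[gpt i]>%VS in
  [/\ lightlike_gauss_map G, legendre_immersion x G, omega_dual x G &
      regular_surface x -> linear_weingarten s x G].
Proof.
move=> ss x G; have -> : x = fun i => s *: ypt t i + (1 - s * t) *: gpt i.
  by apply: boolp.funext => i; exact: weierstrass_span.
split.
- exact: (lightlike_line_span mink_ypt_gpt mink_gpt prod_gpt).
- exact: (legendre_span t mink_ypt_gpt mink_gpt edge_ypt_gpt prod_gpt).
- exact: (omega_dual_span mink_ypt mink_ypt_gpt mink_gpt edge_ypt_gpt diag_ypt_gpt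
    planar_gpt prod_gpt).
- exact: (linear_weingarten_span mink_ypt mink_ypt_gpt mink_gpt edge_ypt_gpt
    diag_ypt_gpt planar_gpt prod_gpt).
Qed.

End Representation.

Theorem theorem4p12 (R : realType)
    (m : vertex -> vertex -> R) (psi : vertex -> R[i])
    (t lam : R) (sg : vertex -> vertex -> R[i]) (E : vertex -> 'M[R[i]]_2) :
  discrete_holomorphic m psi ->
  lam != 0 ->
  (forall i, calT t psi i != 0) ->
  (forall i j, edge i j -> 1 - lam / m i j != 0) ->
  edge_sqrt m lam sg ->
  (forall i, \det (E i) = 1) ->
  (forall i j, edge i j ->
     invmx (E i) *m E j = transition m lam sg psi i j) ->
  exists eps : vertex -> R, edge_sign m lam eps /\
  let fp : surface R := fun i => eps i *: weierstrass 1 t psi E i in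
  let fm : surface R := fun i => eps i *: weierstrass (-1) t psi E i in
  exists G : vertex -> {vspace mink_space R},
    [/\ lightlike_gauss_map G,
        legendre_immersion fp G /\ legendre_immersion fm G,
        omega_dual fp G /\ omega_dual fm G
      & (regular_surface fp -> BrLW fp G) /\ (regular_surface fm -> BiLW fm G)].

Proof.
move=> holo lam0 T0 q0 sqrts detE stepE.
have [eps epsP] := edge_sign_exists holo.1 q0.
exists eps; split=> // fp fm; exists (fun i => <[gpt psi E eps t i]>%VS).
have rep := representation_omega_dual holo lam0 q0 sqrts detE stepE epsP T0.
have [light legp dualp wp] := rep 1 (mulr1 1).
have [_ legm dualm wm] := rep (-1) (etrans (mulrNN 1 1) (mulr1 1)).
exact: And4 light (conj legp legm) (conj dualp dualm) (conj wp wm).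
Qed.
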